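(* $$1.6\le \liminf_{G\ \text{3-flow-critical}} \frac{|E(G)|}{|V(G)|}\le \frac{5}{3}.$$
   Context: A nowhere-zero $3$-flow in a graph $G$ consists of an orientation of the edges of $G$ and an assignment of a value from $\{\pm1,\pm2\}$ to each edge such that at every vertex the sum of the values on outgoing edges equals the sum of the values on incoming edges. A bridgeless graph $G$ (not necessarily planar) is $3$-flow-critical if it has no nowhere-zero $3$-flow, but for every edge $e\in E(G)$ the graph $G/e$ obtained by contracting $e$ has one. The limit inferior is over all $3$-flow-critical graphs $G$, as the number of vertices tends to infinity. The lower bound $1.6$ is due to Li, Ma, Shi, Wang and Wu; the upper bound $\frac{5}{3}$ follows by taking planar duals of $4$-critical plane graphs with $n$ vertices and $2.5n+o(n)$ edges.
   Formalization: 3-flow-critical graphs are additionally required to be connected; otherwise K_4 together with m isolated vertices would be 3-flow-critical with density 6/(4+m), and the limit inferior would be 0. *)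

(* Defs.v *)
From HB Require Import structures.
From mathcomp Require Import all_boot all_order all_algebra.
From mathcomp Require Import all_classical all_reals all_analysis.

Set Implicit Arguments.
Unset Strict Implicit.
Unset Printing Implicit Defensive.

Import Order.TTheory GRing.Theory Num.Theory.

Local Open Scope ring_scope.

(* Finite graphs, possibly with loops and parallel edges (contraction can
   create both). The order of the two components of [ends e] has no meaning:
   orientations are chosen separately, see [arc_tail] and [arc_head]. *)
Record mgraph := MGraph {
  vertex : finType;
  edge : finType;
  ends : edge -> vertex * vertex
}.

Section Graph.
Variable G : mgraph.

Definition adjacent : rel (vertex G) := fun u v =>
  [exists e : edge G, (ends e == (u, v)) || (ends e == (v, u))].

Definition connected_graph : Prop :=
  forall u v : vertex G, connect adjacent u v.

Definition delete_edge (e : edge G) : mgraph :=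
  @MGraph (vertex G) {f : edge G | f != e} (fun f => ends (val f)).

(* The second end of e is removed and replaced by the first one. When e is a
   loop no vertex is removed, so contracting a loop amounts to deleting it. *)
Definition contract_keep (e : edge G) : pred (vertex G) :=
  fun v => (v == (ends e).1) || (v != (ends e).2).

Definition contract_map (e : edge G) (v : vertex G) : vertex G :=
  if v == (ends e).2 then (ends e).1 else v.

Lemma contract_mapP (e : edge G) (v : vertex G) :
  contract_keep e (contract_map e v).
Proof.
rewrite /contract_keep /contract_map.
by case: (boolP (v == (ends e).2)) => [_|->]; rewrite ?eqxx ?orbT.
Qed.

Definition contract_vertex (e : edge G) (v : vertex G) :
    {v : vertex G | contract_keep e v} :=
  exist _ (contract_map e v) (contract_mapP e v).

Definition contract (e : edge G) : mgraph :=
  @MGraph {v : vertex G | contract_keep e v} {f : edge G | f != e}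
    (fun f => (contract_vertex e (ends (val f)).1,
               contract_vertex e (ends (val f)).2)).

End Graph.

Definition bridge (G : mgraph) (e : edge G) : Prop :=
  ~ connect (@adjacent (delete_edge e)) (ends e).1 (ends e).2.

Definition bridgeless (G : mgraph) : Prop := forall e : edge G, ~ bridge e.

(* An orientation is given by the set of edges e that are directed from
   [(ends e).2] to [(ends e).1]. *)
Definition arc_tail (G : mgraph) (o : edge G -> bool) (e : edge G) : vertex G :=
  if o e then (ends e).2 else (ends e).1.

Definition arc_head (G : mgraph) (o : edge G -> bool) (e : edge G) : vertex G :=
  if o e then (ends e).1 else (ends e).2.

Definition has_nowhere_zero_3_flow (G : mgraph) : Prop :=
  exists (o : edge G -> bool) (f : edge G -> int),
    (forall e : edge G, f e \in [:: 1; -1; 2; -2]) /\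
    (forall v : vertex G,
       \sum_(e : edge G | arc_tail o e == v) f e =
       \sum_(e : edge G | arc_head o e == v) f e).

(* Without connectedness, isolated vertices could be added to a critical graph
   and the density |E| / |V| would have infimum 0. *)
Definition three_flow_critical (G : mgraph) : Prop :=
  [/\ connected_graph G, bridgeless G, ~ has_nowhere_zero_3_flow G &
      forall e : edge G, has_nowhere_zero_3_flow (contract e)].

Definition density (R : realType) (G : mgraph) : R :=
  #|edge G|%:R / #|vertex G|%:R.

(* The infimum is +oo if there is no critical graph with n vertices. *)
Definition inf_critical_density (R : realType) (n : nat) : \bar R :=
  ereal_inf [set x : \bar R | exists G : mgraph,
    [/\ three_flow_critical G, #|vertex G| = n & x = (density R G)%:E]].

(* The limit inferior of |E(G)| / |V(G)| over 3-flow-critical graphs G, as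
   |V(G)| tends to infinity. *)
Definition liminf_critical_density (R : realType) : \bar R :=
  limn_einf (inf_critical_density R).

(* Main.v *)
(** A 3-flow-critical graph has no nowhere-zero flow over Z/3, but every edge is
    the zero set of some flow over Z/3: contracting an edge amounts to dropping
    the nonzero condition on it, and nowhere-zero flows over Z/3 lift to integral
    ones.

    Lower bound. Every degree is at least 3. Let T be the set of cubic vertices,
    one vertex being left out. Sending an edge set inside T to its degree
    parities on T and to the parity of its size is injective, so T spans at most
    |T| + 1 edges, and counting degrees gives 5 |E| >= 8 |V| - 3. For the
    injectivity, a nonempty edge set Z inside T with even degrees and even size
    is left by some edge e by connectedness; take the flow vanishing exactly on e
    and count the ends of edges of Z at which the outgoing value is -1. Each edge
    of Z contributes one, while a cubic vertex contributes an even number, unless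
    e is incident to it, and then one.

    Upper bound. A grid-like graph: every column is a path of cubic vertices, so
    that in a nowhere-zero flow its values are s, -s, s, ... for a sign s, and
    every row is a path of quartic vertices from H to T, with values w - s at the
    crossing with a column of sign s. The edge between U and H forces two columns
    of different signs, hence w = 0 for every row, and then the edge between T
    and H has value 0. Explicit flows show that every edge can be dropped. With k
    rows and 2 k columns, 3 |E| - 5 |V| = 11 k - 9 is negligible against |V|. *)

From Pilot Require Import Defs.
From mathcomp Require Import all_boot all_order all_algebra.
From mathcomp Require Import all_classical all_reals all_analysis.
From mathcomp Require Import zify ring lra.

Set Implicit Arguments.
Unset Strict Implicit.
Unset Printing Implicit Defensive.

(* Restores [contract], [set0] and other names shadowed by the libraries above. *)
Import mathcomp.boot.fintype mathcomp.boot.finset Pilot.Defs.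
Import Order.TTheory GRing.Theory Num.Theory.

Local Open Scope ring_scope.

(** * Net outflow and conservation over an abelian group *)

Section Net.
Variables (G : mgraph) (V : zmodType).
Implicit Types (x y : edge G -> V) (v : vertex G) (A : {pred vertex G}).

Definition net x v : V :=
  \sum_e (x e *+ ((ends e).1 == v) - x e *+ ((ends e).2 == v)).

Definition conserving x := forall v, net x v = 0.

Lemma eq_net x y : x =1 y -> net x =1 net y.
Proof. by move=> xy v; apply: eq_bigr => e _; rewrite xy. Qed.

Lemma netE x v :
  net x v = \sum_(e | (ends e).1 == v) x e - \sum_(e | (ends e).2 == v) x e.
Proof.
rewrite /net sumrB; congr (_ - _); rewrite [RHS]big_mkcond /=;
  by apply: eq_bigr => e _; case: (_ == v).
Qed.

Lemma netD x y v : net (fun e => x e + y e) v = net x v + net y v.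
Proof.
rewrite /net -big_split; apply: eq_bigr => e _ /=.
by rewrite !mulrnDl opprD addrACA.
Qed.

Lemma net_single e (c : V) v :
  net (fun f => c *+ (f == e)) v =
  c *+ ((ends e).1 == v) - c *+ ((ends e).2 == v).
Proof.
rewrite /net (bigD1 e) //= eqxx big1 ?addr0 // => f /negPf ->.
by rewrite !mul0rn subrr.
Qed.

Lemma sum_net x A :
  \sum_(v in A) net x v =
  \sum_e (x e *+ ((ends e).1 \in A) - x e *+ ((ends e).2 \in A)).
Proof.
rewrite /net exchange_big; apply: eq_bigr => e _ /=.
have sumE w : \sum_(v in A) x e *+ (w == v) = x e *+ (w \in A).
  have [wA|wA] := boolP (w \in A); last first.
    by rewrite big1 // => v vA; case: eqP wA => // ->; rewrite vA.
  rewrite (bigD1 w) //= eqxx big1 ?addr0 // => v /andP[_].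
  by rewrite eq_sym => /negPf ->.
by rewrite sumrB !sumE.
Qed.

Lemma sum_net_all x : \sum_v net x v = 0.
Proof. by rewrite (sum_net x predT) big1 // => e _; rewrite subrr. Qed.

End Net.

(** * Lifting flows from Z/3 to the integers *)

Section Tutte.
Variable G : mgraph.
Implicit Types (g : edge G -> int) (u v w : vertex G) (e : edge G).

Definition small g := forall e, g e \in [:: 1; -1; 2; -2].

Lemma smallP g e : small g -> [\/ g e = 1, g e = -1, g e = 2 | g e = -2].
Proof.
move/(_ e); rewrite !inE => /or4P[] /eqP ge.
- exact: Or41.
- exact: Or42.
- exact: Or43.
- exact: Or44.
Qed.

(** The steps along which flow really runs, a negative value being flow from the second end to the
    first. *)
Definition residual g : rel (vertex G) := fun u v =>
  [exists e, (ends e == (u, v)) && (0 < g e) || (ends e == (v, u)) && (g e < 0)].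

(** Lowering the flow by 3 in its own direction turns 1, 2 into -2, -1, so values stay admissible.
    The clause on unchanged edges serves the induction: the first edge keeps its value while the
    rest of the path is treated. *)
Lemma push_path g u p : small g -> path (residual g) u p -> uniq (u :: p) ->
  exists g', [/\ small g',
    forall v, net g' v = net g v - 3 *+ (u == v) + 3 *+ (last u p == v) &
    forall e, ~~ (((ends e).1 \in u :: p) && ((ends e).2 \in u :: p)) ->
      g' e = g e].
Proof.
elim: p u g => [|w p IH] u g smg.
  by move=> _ _; exists g; split=> // v /=; rewrite subrK.
move=> /= /andP[/existsP[e res_e] /(IH _ _ smg)] {IH} IH.
case/and3P=> u_p w_p p_uniq; case: IH => [|g1 [smg1 net1 eq1]].
  by rewrite /= w_p.
have uwp : u \in w :: p = false by apply/negbTE.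
have g1e : g1 e = g e.
  apply: eq1; case/orP: res_e => /andP[/eqP -> _] /=; last by rewrite uwp andbF.
  by rewrite uwp.
pose c : int := if 0 < g e then -3 else 3.
exists (fun f => g1 f + c *+ (f == e)); split.
- move=> f; case: eqP => [->|_]; last by rewrite addr0.
  rewrite g1e /c; case/orP: res_e => /andP[_];
  by case: (smallP e smg) => ->.
- move=> v; rewrite netD net_single net1 /c.
  case/orP: res_e => /andP[/eqP -> /= sg].
    rewrite sg; lia.
  rewrite ltNge ltW //=; lia.
move=> f; rewrite negb_and => nf.
case: eqP => [fe|_].
  move: nf; rewrite fe.
  by case/orP: res_e => /andP[/eqP -> _] /=; rewrite !inE !eqxx ?orbT.
rewrite addr0; apply: eq1; rewrite negb_and.
by case/orP: nf => /=; rewrite inE negb_or => /andP[_ ->]; rewrite ?orbT.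
Qed.

(** No flow leaves the set reachable from [u], so its nets sum to at most 0 and the surplus at [u]
    is compensated inside it. *)
Lemma residual_deficit g u : 0 < net g u ->
  exists2 w, connect (residual g) u w & net g w < 0.
Proof.
move=> u_pos; pose A : {pred vertex G} := connect (residual g) u.
have sumA : \sum_(v in A) net g v <= 0.
  rewrite sum_net; apply: sumr_le0 => e _.
  have [tA|tA] := boolP (_ \in A); have [hA|hA] := boolP (_ \in A);
    rewrite ?subrr // ?subr0 ?sub0r ?oppr_le0 leNgt; apply/negP => ge.
    move/negP: hA; apply; apply: connect_trans tA (connect1 _).
    by apply/existsP; exists e; rewrite -surjective_pairing eqxx ge.
  move/negP: tA; apply; apply: connect_trans hA (connect1 _).
  by apply/existsP; exists e; rewrite -surjective_pairing eqxx ge orbT.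
have [/existsP[w /andP[]]|/existsPn A_ge0] :=
  boolP [exists w, connect (residual g) u w && (net g w < 0)].
  by exists w.
suff : 0 < \sum_(v in A) net g v by rewrite ltNge sumA.
rewrite (bigD1 u) /=; last exact: connect0.
rewrite ltr_wpDr // sumr_ge0 // => v /andP[vA _].
by have := A_ge0 v; rewrite (vA : connect _ _ _) -leNgt.
Qed.

Lemma balance_mod3 g : small g -> (forall v, (3 %| net g v)%Z) ->
  exists2 g', small g' & conserving g'.
Proof.
move: {2}(\sum_v `|net g v|)%N (leqnn (\sum_v `|net g v|)%N) => n.
elim: n g => [|n IH] g le_n smg div3.
  exists g => // v; apply/eqP; rewrite -absz_eq0 -leqn0.
  by apply: leq_trans le_n; rewrite (bigD1 v) //= leq_addr.
have [/existsP[u u_pos]|/existsPn le0] := boolP [exists u, 0 < net g u]; last first.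
  exists g => // v; apply/eqP; rewrite -oppr_eq0; apply/eqP; move: v (erefl true).
  apply: psumr_eq0P; last by rewrite sumrN sum_net_all oppr0.
  by move=> v _; rewrite oppr_ge0 leNgt; exact: le0.
(* Pushing 3 units from a surplus to a deficit lowers the sum of the absolute nets, as both nets are
   nonzero multiples of 3. *)
have [w u_w w_neg] := residual_deficit u_pos.
case/connectP: u_w => p0 /shortenP[p path_p uniq_p _] def_w.
have [g' [smg' net' _]] := push_path smg path_p uniq_p.
have uw : (u == w) = false by apply: contraTF u_pos => /eqP ->; rewrite -leNgt ltW.
apply: IH smg' _; last first.
  by move=> v; rewrite net'; have := div3 v; case: (u == v); case: (_ == v); lia.
rewrite -ltnS; apply: leq_trans le_n.
rewrite (bigD1 u) //= [ltnRHS](bigD1 u) //= -addSn leq_add //.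
  have := div3 u; rewrite net' eqxx -def_w eq_sym uw; lia.
apply: leq_sum => v vu; rewrite net' -def_w eq_sym (negPf vu).
case: eqP => [<-|_]; have := div3 w; lia.
Qed.

End Tutte.

Lemma F3_cases (c : 'F_3) : [\/ c = 0, c = 1 | c = -1].
Proof.
case: c => [[|[|[|//]]] lt_c]; [apply: Or31|apply: Or32|apply: Or33]; exact: val_inj.
Qed.

Lemma net_intr (G : mgraph) (g : edge G -> int) (x : edge G -> 'F_3) :
  (forall e, (g e)%:~R = x e) -> forall v, (net g v)%:~R = net x v.
Proof.
move=> gx v; rewrite /net rmorph_sum; apply: eq_bigr => e _ /=.
by rewrite rmorphB !rmorphMn /= gx.
Qed.

(* The backward direction is Tutte's theorem that nowhere-zero flows over Z/3
   lift to integral ones. *)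
Theorem nowhere_zero_3_flowP (G : mgraph) :
  has_nowhere_zero_3_flow G <->
  exists2 x : edge G -> 'F_3, conserving x & forall e, x e != 0.
Proof.
split=> [[d [f [f_small f_flow]]]|[x x_flow x_neq0]].
  pose g e := if d e then - f e else f e.
  have g_net v : net g v = 0.
    rewrite /net -[RHS](subrr (\sum_(e | arc_tail d e == v) f e)).
    rewrite {2}f_flow 2!(big_mkcond (fun e => _ == v)) -sumrB.
    apply: eq_bigr => e _; rewrite /g /arc_tail /arc_head.
    by case: (d e); do 2!case: (_ == v);
      rewrite ?mulr0n ?mulr1n ?subr0 ?sub0r ?opprK // addrC.
  exists (fun e => (g e)%:~R).
    by move=> v; rewrite -(@net_intr G g) // g_net.
  move=> e; rewrite /g; have := f_small e.
  by rewrite !inE => /or4P[]/eqP ->; case: (d e).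
pose g e : int := if x e == 1 then 1 else -1.
have gx e : (g e)%:~R = x e.
  by rewrite /g; have := x_neq0 e; case: (F3_cases (x e)) => ->.
have [|v|g' g'_small g'_flow] := @balance_mod3 G g.
- by move=> e; rewrite /g; case: ifP.
- by rewrite (dvdz_pcharf (pchar_Fp (isT : prime 3))) (net_intr gx) x_flow.
exists (fun=> false), g'; split=> // v.
by apply/eqP; rewrite -subr_eq0 -netE; apply/eqP.
Qed.

Lemma conserving_but_one (G : mgraph) (V : zmodType) (x : edge G -> V) r :
  (forall v, v != r -> net x v = 0) -> conserving x.
Proof.
move=> net0 v; have [->|] := eqVneq v r; last exact: net0.
by have := sum_net_all x; rewrite (bigD1 r) //= big1 ?addr0.
Qed.

(** * Flows of a contracted graph *)

Section Contraction.
Variables (G : mgraph) (e : edge G).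
Let t := (ends e).1.
Let h := (ends e).2.

Lemma net_contract (V : zmodType) (x : edge G -> V) (w : vertex (contract e)) :
  net (fun f : edge (contract e) => x (val f)) w =
  \sum_(v | contract_map e v == val w) net x v.
Proof.
rewrite (sum_net x (fun v => contract_map e v == val w)) (bigD1 e) //=.
rewrite [X in X + _](_ : _ = 0) ?add0r; last first.
  rewrite !unfold_in /= /contract_map eqxx.
  by case: ifP => _; rewrite subrr.
by rewrite (big_sub (fun f => f != e)).
Qed.

Lemma contract_flowP : has_nowhere_zero_3_flow (contract e) <->
  exists2 x : edge G -> 'F_3, conserving x & forall f, f != e -> x f != 0.
Proof.
rewrite nowhere_zero_3_flowP; split=> [[y y_flow y_neq0]|[x x_flow x_neq0]]; last first.
  exists (fun f => x (val f)); last by case=> f fe; exact: x_neq0.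
  by move=> w; rewrite net_contract big1.
pose x0 f : 'F_3 := oapp y 0 (insub f : option (edge (contract e))).
have x0y : (fun f : edge (contract e) => x0 (val f)) =1 y.
  by move=> f; rewrite /x0 valK.
(* The contracted edge takes the value that balances [h]; balance at [t] then follows from that at
   all other vertices. *)
pose x f := x0 f + (net x0 h) *+ (f == e).
exists x; last first.
  move=> f fe; rewrite /x (negPf fe) addr0.
  by rewrite [x0 f](x0y (exist _ f fe : edge (contract e))).
apply: (@conserving_but_one _ _ _ t) => v vt.
rewrite netD net_single -/t -/h [t == v]eq_sym (negPf vt) sub0r.
have [->|hv] := eqVneq h v; first by rewrite subrr.
have kv : contract_keep e v by rewrite /contract_keep -/h [v == h]eq_sym hv orbT.
rewrite mulr0n subr0.
rewrite -[LHS](_ : net (fun f : edge (contract e) => x0 (val f)) (exist _ v kv) = _).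
  by rewrite (eq_net x0y) y_flow.
rewrite net_contract (big_pred1 v) // => u /=.
rewrite /contract_map -/t -/h; case: (eqVneq u h) => // ->.
by rewrite (negPf hv) eq_sym (negPf vt).
Qed.

End Contraction.

(** * Flows with a single zero in critical graphs *)

Section Critical.
Variable G : mgraph.
Hypothesis G_crit : three_flow_critical G.

Lemma critical_flow (e : edge G) : exists x : edge G -> 'F_3,
  [/\ conserving x, x e = 0 & forall f, f != e -> x f != 0].
Proof.
case: G_crit => _ _ no_flow /(_ e) /contract_flowP[x x_flow x_neq0].
exists x; split=> //; apply/eqP/negPn/negP => xe.
apply/no_flow/nowhere_zero_3_flowP; exists x => // f.
by have [->|/x_neq0] := eqVneq f e.
Qed.

(** Conservation does not see a loop, so a zero on a loop could be replaced by 1. *)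
Lemma critical_loopless (e : edge G) : (ends e).1 != (ends e).2.
Proof.
apply/negP => /eqP loop_e; have [x [x_flow xe x_neq0]] := critical_flow e.
case: G_crit => _ _ no_flow _.
apply/no_flow/nowhere_zero_3_flowP; exists (fun f => x f + 1 *+ (f == e)).
  by move=> v; rewrite netD x_flow net_single loop_e subrr addr0.
move=> f; have [->|/x_neq0] := eqVneq f e; first by rewrite xe add0r.
by rewrite addr0.
Qed.

End Critical.

(** * Parity of symmetric differences *)

Section SymmetricDifference.
Variable T : finType.
Implicit Types A B C : {set T}.

Definition symdiff A B := [set x | (x \in A) (+) (x \in B)].

Lemma odd_card_symdiff A B : odd #|symdiff A B| = odd #|A| (+) odd #|B|.
Proof.
suff : (#|symdiff A B| + #|A :&: B|.*2 = #|A| + #|B|)%N.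
  by move/(congr1 odd); rewrite !oddD odd_double addbF.
have -> : symdiff A B = (A :\: B) :|: (B :\: A).
  by apply/setP => x; rewrite !inE; do 2!case: (_ \in _).
rewrite cardsU (_ : (_ :\: _) :&: _ = set0) ?cards0 ?subn0; last first.
  by apply/setP => x; rewrite !inE; do 2!case: (_ \in _).
by rewrite -(cardsID B A) -(cardsID A B) [B :&: A]setIC; lia.
Qed.

Lemma setI_symdiff C A B : C :&: symdiff A B = symdiff (C :&: A) (C :&: B).
Proof. by apply/setP => x; rewrite !inE; do 3!case: (_ \in _). Qed.

Lemma symdiff_eq0 A B : symdiff A B = set0 -> A = B.
Proof.
by move/setP => AB; apply/setP => x; have := AB x; rewrite !inE; do 2!case: (_ \in _).
Qed.

End SymmetricDifference.

(** * Edges at a vertex, and double counting of incidences *)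

Section Incidence.
Variable G : mgraph.
Implicit Types (e f : edge G) (v : vertex G).

Definition star v : {set edge G} := [set e | ((ends e).1 == v) || ((ends e).2 == v)].

Lemma connect_leaves (A : {pred vertex G}) u v : connect (@adjacent G) u v ->
  u \in A -> v \notin A -> exists e, ((ends e).1 \in A) != ((ends e).2 \in A).
Proof.
move=> uv uA vA; apply/existsP; apply: contraNT vA => /existsPn noA.
suff <- : (u \in A) = (v \in A) by [].
apply: (closed_connect _ uv) => x y /existsP[e].
by have := noA e; rewrite negbK => /eqP xA /orP[] /eqP exy; rewrite exy /= in xA.
Qed.

Hypothesis G_loopless : forall e, (ends e).1 != (ends e).2.

Lemma sum_star (A : {pred vertex G}) (B : {pred edge G}) (F : vertex G -> edge G -> nat) :
  (\sum_(v in A) \sum_(e in B | e \in star v) F v e =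
   \sum_(e in B) ((if (ends e).1 \in A then F (ends e).1 e else 0) +
                  (if (ends e).2 \in A then F (ends e).2 e else 0)))%N.
Proof.
rewrite (exchange_big_dep (mem B)) /=; last by move=> v e _ /andP[].
apply: eq_bigr => e eB; rewrite eB /=.
have th := G_loopless e.
rewrite (eq_bigl (fun v => (v \in A) && (v \in [set (ends e).1; (ends e).2]))); last first.
  by move=> v; rewrite !inE ![v == _]eq_sym.
rewrite (eq_bigl (fun v => (v \in [set (ends e).1; (ends e).2]) && (v \in A))); last first.
  by move=> v; rewrite andbC.
rewrite big_mkcondr /= big_setU1 ?inE //= big_set1; lia.
Qed.

Definition out_value (x : edge G -> 'F_3) v e : 'F_3 :=
  if (ends e).1 == v then x e else - x e.

Lemma out_value_eq0 x v e : (out_value x v e == 0) = (x e == 0).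
Proof. by rewrite /out_value; case: ifP; rewrite ?oppr_eq0. Qed.

Lemma net_star (x : edge G -> 'F_3) v :
  net x v = \sum_(e in star v) out_value x v e.
Proof.
rewrite /net [RHS]big_mkcond; apply: eq_bigr => e _; rewrite inE /out_value.
have := G_loopless e; have [->|_] := eqVneq (ends e).1 v => th.
  by rewrite [(ends e).2 == v]eq_sym (negPf th) /= mulr0n subr0.
by case: (_ == v); rewrite mulr0n sub0r ?oppr0.
Qed.

End Incidence.

(** * Lower bound: sparsity of the cubic part *)

Section LowerBound.
Variable G : mgraph.
Hypothesis G_crit : three_flow_critical G.
Hypothesis G_gt1 : (1 < #|vertex G|)%N.
Implicit Types (x : edge G -> 'F_3) (e f : edge G) (v : vertex G).

Let loopless := critical_loopless G_crit.

(** A single edge at [v] would be a bridge; with exactly two, a flow vanishing on one would vanish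
    on the other. *)
Lemma critical_degree v : (2 < #|star v|)%N.
Proof.
have [G_conn G_bridgeless _ _] := G_crit.
have [w wv] : exists w, w != v.
  apply/existsP; rewrite -negb_forall; apply: contraL G_gt1 => /forallP all_v.
  by rewrite -leqNgt (@eq_card1 _ v) // => w; rewrite !inE all_v.
have [e ev] : exists e, e \in star v.
  have [||e] := @connect_leaves G (pred1 v) v w (G_conn v w); rewrite ?inE //.
  by move=> ev; exists e; rewrite inE; move: ev; do 2!case: (_ == v).
have [f fv fe] : exists2 f, f \in star v & f != e.
  suff [f ff] : exists f : edge (delete_edge e),
    ((ends f).1 == v) != ((ends f).2 == v).
    exists (val f); last exact: valP f.
    by rewrite inE; move: ff; do 2!case: (_ == v).
  have /negP/negPn e_conn : ~ ~~ connect (@adjacent (delete_edge e)) (ends e).1 (ends e).2.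
    by move=> ne; apply: (G_bridgeless e) => /(negP ne).
  have th := loopless e; move: ev; rewrite inE.
  have [tv _|tv /= hv] := eqVneq (ends e).1 v.
    rewrite tv in th e_conn.
    have [||f ff] := @connect_leaves (delete_edge e) (pred1 v) _ _ e_conn.
    - by rewrite inE.
    - by rewrite inE eq_sym.
    by exists f.
  have [||f ff] := @connect_leaves (delete_edge e) (predC1 v) _ _ e_conn.
  - by rewrite inE.
  - by rewrite inE negbK.
  by exists f; move: ff; rewrite !inE; do 2!case: (_ == v).
rewrite ltnNge; apply/negP => le2.
have star_v : [set e; f] = star v.
  by apply/eqP; rewrite eqEcard cards2 eq_sym fe le2 andbT subUset !sub1set ev fv.
have [x [x_flow xe x_neq0]] := critical_flow G_crit e.
have := x_flow v; rewrite (net_star loopless) -star_v big_setU1 ?inE 1?eq_sym //= big_set1.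
have := x_neq0 f fe; rewrite -(out_value_eq0 x v f) => /negPf of_neq0.
have /eqP -> : out_value x v e == 0 by rewrite out_value_eq0 xe.
by rewrite add0r => /eqP; rewrite of_neq0.
Qed.

(** Three nonzero elements of Z/3 with sum zero are equal. *)
Lemma cubic_out x v e f : conserving x -> #|star v| = 3%N ->
  {in star v, forall g, x g != 0} -> e \in star v -> f \in star v ->
  out_value x v e = out_value x v f.
Proof.
move=> x_flow card3 x_neq0 ev fv; have [->//|ef] := eqVneq e f.
have fve : f \in star v :\ e by rewrite in_setD1 eq_sym ef fv.
have /cards1P[g def_g] : #|star v :\ e :\ f| == 1%N.
  by have := cardsD1 e (star v); have := cardsD1 f (star v :\ e); rewrite ev fve card3; lia.
have gv : g \in star v.
  have : g \in star v :\ e :\ f by rewrite def_g set11.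
  by rewrite !in_setD1 => /and3P[].
have := x_flow v; rewrite (net_star loopless) (big_setD1 e) //= (big_setD1 f) //=.
rewrite def_g big_set1.
have := x_neq0 e ev; have := x_neq0 f fv; have := x_neq0 g gv.
rewrite -(out_value_eq0 x v e) -(out_value_eq0 x v f) -(out_value_eq0 x v g).
case: (F3_cases (out_value x v e)) => ->; case: (F3_cases (out_value x v f)) => ->;
  by case: (F3_cases (out_value x v g)) => ->.
Qed.

Variable r : vertex G.
(** With [r] left out, the vertices met by an edge set inside [T] never exhaust the graph, so some
    edge leaves them. *)
Let T := [set v | (#|star v| == 3%N) && (v != r)].
Let H := [set e | ((ends e).1 \in T) && ((ends e).2 \in T)].

Lemma even_cubic_subgraph_eq0 (Z : {set edge G}) : Z \subset H -> ~~ odd #|Z| ->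
  {in T, forall v, ~~ odd #|star v :&: Z|} -> Z = set0.
Proof.
move=> /subsetP ZH Z_even Z_deg; apply/eqP; apply: contraT => /set0Pn[z zZ].
pose W := [set v | star v :&: Z != set0].
have WT v : v \in W -> v \in T.
  rewrite inE => /set0Pn[e /setIP[ev /ZH]]; rewrite inE => /andP[].
  by move: ev; rewrite inE => /orP[] /eqP ->.
have ZW e : e \in Z -> ((ends e).1 \in W) && ((ends e).2 \in W).
  by move=> eZ; rewrite !inE; apply/andP; split; apply/set0Pn; exists e;
    rewrite !inE eqxx ?orbT.
have rW : r \notin W by apply/negP => /WT; rewrite inE eqxx andbF.
have [G_conn _ _ _] := G_crit.
have [||e0 e0W] := connect_leaves (A := mem W) (G_conn (ends z).1 r).
- by case/andP: (ZW z zZ).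
- by [].
have e0Z : e0 \notin Z.
  by apply/negP => /ZW /andP[tW hW]; move: e0W; rewrite /= tW hW.
(* Exactly one end of [e0] lies in [W]; it is the only exceptional vertex in the count below. *)
have [a aW aE] : exists2 a, a \in W & forall v, v \in W -> (e0 \in star v) = (v == a).
  move: e0W => /=; have [tW|tW] := boolP ((ends e0).1 \in W);
    have [hW|hW] := boolP ((ends e0).2 \in W) => // _.
    exists (ends e0).1 => // v vW; rewrite inE orbC ![_ == v]eq_sym.
    by case: eqP => // vh; rewrite vh (negPf hW) in vW.
  exists (ends e0).2 => // v vW; rewrite inE ![_ == v]eq_sym.
  by case: eqP => // vt; rewrite vt (negPf tW) in vW.
have [x [x_flow xe0 x_neq0]] := critical_flow G_crit e0.
pose N v := (\sum_(e in Z | e \in star v) (out_value x v e == -1)%R)%N.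
have NE v : N v = (\sum_(e in star v :&: Z) (out_value x v e == -1)%R)%N.
  by apply: eq_bigl => e; rewrite in_setI andbC.
(* An edge of [Z] has opposite nonzero outgoing values at its two ends, so exactly one of them is
   -1. *)
have sumN : (\sum_(v in W) N v = #|Z|)%N.
  rewrite (sum_star loopless (mem W)) -sum1_card; apply: eq_bigr => e eZ.
  case/andP: (ZW e eZ) => /= -> ->; rewrite /out_value eqxx (negPf (loopless e)).
  have : x e != 0 by apply: x_neq0; apply: contraNneq e0Z => <-.
  by case: (F3_cases (x e)) => ->.
have odd_sum (I : finType) (P : pred I) (F : I -> nat) :
  (forall i, P i -> ~~ odd (F i)) -> ~~ odd (\sum_(i | P i) F i).
  move=> evenF; rewrite (big_morph odd oddD (erefl : odd 0 = false)) big1 // => i.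
  by move/evenF/negPf.
move: Z_even; rewrite -sumN (bigD1 a) //= oddD => /negP[].
(* Away from [a] all outgoing values at [v] agree, so [N v] is 0 or the even degree of [v] in
   [Z]. *)
rewrite [X in _ (+) X](negPf (odd_sum _ _ _ _)) ?addbF => [|v /andP[vW va]]; last first.
  have [e1 e1v] : exists e, e \in star v :&: Z by apply/set0Pn; rewrite inE in vW.
  rewrite NE (eq_bigr (fun=> (out_value x v e1 == -1)%R : nat)) => [|e]; last first.
    move=> /setIP[ev _]; rewrite (@cubic_out x v e e1) //.
    - by have := WT v vW; rewrite inE => /andP[/eqP].
    - by move=> g gv; apply: x_neq0; apply: contraTneq gv => ->; rewrite aE.
    - by case/setIP: e1v.
  by rewrite sum_nat_const oddM (negPf (Z_deg v (WT v vW))).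
have card3 : #|star a| = 3%N by have := WT a aW; rewrite inE => /andP[/eqP].
have e0a : e0 \in star a by rewrite aE.
have card2 : #|star a :\ e0| = 2%N by have := cardsD1 e0 (star a); rewrite e0a card3; case.
(* The degree of [a] in [Z] is positive and even, and [e0] is not in [Z], so both other edges at [a]
   lie in [Z]. Their outgoing values are opposite, whence [N a] is 1. *)
have starZ : star a :&: Z = star a :\ e0.
  apply/eqP; rewrite eqEcard card2; apply/andP; split.
    apply/subsetP => e /setIP[ea eZ]; rewrite in_setD1 ea andbT.
    by apply: contraNneq e0Z => <-.
  have := Z_deg a (WT a aW); move: aW; rewrite inE -card_gt0.
  by case: #|_| => [|[|]].
have /cards2P[f [g [fg def_fg]]] : #|star a :\ e0| == 2%N by rewrite card2.
have x_neq e : e \in star a :\ e0 -> out_value x a e != 0.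
  by rewrite in_setD1 => /andP[ee0 _]; rewrite out_value_eq0 x_neq0.
have := x_flow a; rewrite (net_star loopless) (big_setD1 e0) //=.
have /eqP -> : out_value x a e0 == 0 by rewrite out_value_eq0 xe0.
have := x_neq f; have := x_neq g; rewrite NE starZ def_fg set21 set22.
rewrite !big_setU1 ?inE //= !big_set1 => /(_ isT) + /(_ isT).
by case: (F3_cases (out_value x a f)) => ->; case: (F3_cases (out_value x a g)) => ->.
Qed.

(** Two edge sets with equal parity data have an even symmetric difference, which is empty; so 2^|H|
    is at most 2^(|T|+1). *)
Lemma card_cubic_edges : (#|H| <= #|T|.+1)%N.
Proof.
pose phi (A : {set edge G}) : {set vertex G} * bool :=
  ([set v in T | odd #|star v :&: A|], odd #|A|).
have phi_inj : {in powerset H &, injective phi}.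
  move=> A B; rewrite !inE => AH BH [/setP deg_eq card_eq].
  apply: symdiff_eq0; apply: even_cubic_subgraph_eq0.
  - apply/subsetP => e; rewrite inE.
    have := subsetP AH e; have := subsetP BH e.
    by case: (e \in A); case: (e \in B).
  - by rewrite odd_card_symdiff card_eq addbb.
  - move=> v vT; rewrite setI_symdiff odd_card_symdiff.
    by have := deg_eq v; rewrite !inE in vT *; rewrite vT /= => ->; rewrite addbb.
have : phi @: powerset H \subset setX (powerset T) setT.
  apply/subsetP => _ /imsetP[A _ ->]; rewrite !inE andbT.
  by apply/subsetP => v; rewrite inE => /andP[].
move/subset_leq_card; rewrite card_in_imset // cardsX !card_powerset cardsT card_bool.
by rewrite mulnC -expnS leq_exp2l.
Qed.

Lemma critical_edge_bound : (8 * #|vertex G| <= 5 * #|edge G| + 3)%N.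
Proof.
have degE (A : {pred vertex G}) : (\sum_(v in A) #|star v| =
    \sum_e (((ends e).1 \in A) + ((ends e).2 \in A)))%N.
  have := sum_star loopless A predT (fun _ _ => 1%N).
  have -> : (\sum_(v in A) \sum_(e in predT | e \in star v) 1 = \sum_(v in A) #|star v|)%N.
    by apply: eq_bigr => v _; rewrite sum1_card; apply: eq_card => e; rewrite !inE.
  by move=> ->; apply: eq_bigr => e _; do 2!case: (_ \in A).
have total : (\sum_(v in T) #|star v| + \sum_(v in ~: T) #|star v| = 2 * #|edge G|)%N.
  rewrite !degE -big_split /= mulnC -sum_nat_const; apply: eq_bigr => e _.
  by rewrite !in_setC; do 2!case: (_ \in T).
have sumT : (\sum_(v in T) #|star v| = 3 * #|T|)%N.
  rewrite mulnC -sum_nat_const; apply: eq_bigr => v.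
  by rewrite inE => /andP[/eqP].
have cross : (\sum_(v in T) #|star v| <= \sum_(v in ~: T) #|star v| + 2 * #|H|)%N.
  rewrite !degE mulnC -sum_nat_const [X in (_ + X)%N]big_mkcond -big_split /=.
  by apply: leq_sum => e _; rewrite !inE; do 2!case: (_ && _).
(* The extra 1 covers [r], which may be cubic. *)
have degC : (4 * #|~: T| <= \sum_(v in ~: T) #|star v| + 1)%N.
  have rT : r \in ~: T by rewrite !inE eqxx andbF.
  rewrite mulnC -sum_nat_const (bigD1 r) //= [X in (_ <= X + _)%N](bigD1 r) //=.
  rewrite addnAC leq_add //; first by rewrite addn1; exact: critical_degree.
  apply: leq_sum => v /andP[]; rewrite !inE negb_and negbK => + vr.
  by rewrite (negPf vr) orbF; have := critical_degree v; lia.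
(* [cross] and [total] give 2|T| <= |E| + 1, while [degC] and [total] give 4|V| <= 2|E| + |T| +
   1. *)
have := cardsC T; have := card_cubic_edges; lia.
Qed.

End LowerBound.

(** * Upper bound: the grid graphs *)

Section Grid.
Variables R n : nat.

Definition grid_vertex : finType := ('I_R * 'I_n + 'I_n.+1 * 'I_R.*2 + option bool)%type.
Definition grid_edge : finType :=
  ('I_R * 'I_n.+1 + 'I_n.+1 * 'I_(R.*2).+1 + 'I_n.+1 * 'I_R.*2 + bool)%type.

(* Row [a] is the path with vertices [row_vertex a 0], the hub H, up to
   [row_vertex a n.+1], the hub T. Column [b] is the path with vertices
   [column_vertex b 0], ..., [column_vertex b (R.*2).+1]; it goes from U to H
   when [b] is even and from H to U when [b] is odd. An arm joins the inner
   vertex number [i.+1] of column [b] to position [b + odd i] of row [i./2]. *)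
Definition quartic a j : grid_vertex := inl (inl (a, j)).
Definition cubic b i : grid_vertex := inl (inr (b, i)).
Definition hubH : grid_vertex := inr None.
Definition hubT : grid_vertex := inr (Some true).
Definition hubU : grid_vertex := inr (Some false).

(** Positions are natural numbers, and a path reaches its final hub exactly where [insub] fails. *)
Definition row_vertex (a p : nat) : grid_vertex :=
  if p is j.+1 then
    if (insub a, insub j) is (Some a', Some j') then quartic a' j' else hubT
  else hubH.

Definition column_vertex (b p : nat) : grid_vertex :=
  if p is i.+1 then
    if (insub b, insub i) is (Some b', Some i') then cubic b' i'
    else if odd b then hubU else hubH
  else if odd b then hubH else hubU.

#[local] Arguments row_vertex : simpl never.
#[local] Arguments column_vertex : simpl never.

Definition row_edge a b : grid_edge := inl (inl (inl (a, b))).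
Definition column_edge b i : grid_edge := inl (inl (inr (b, i))).
Definition arm b i : grid_edge := inl (inr (b, i)).
Definition edgeTH : grid_edge := inr true.
Definition edgeUH : grid_edge := inr false.

(** At the border, even arms of column 0 end at H and odd arms of column [n] end at T. *)
Definition grid_ends (e : grid_edge) : grid_vertex * grid_vertex :=
  match e with
  | inl (inl (inl (a, b))) => (row_vertex a b, row_vertex a b.+1)
  | inl (inl (inr (b, i))) => (column_vertex b i, column_vertex b i.+1)
  | inl (inr (b, i)) => (column_vertex b i.+1, row_vertex i./2 (b + odd i))
  | inr true => (hubT, hubH)
  | inr false => (hubU, hubH)
  end.

Definition grid := MGraph grid_ends.

Lemma card_grid_vertex : #|vertex grid| = (R * n + n.+1 * R.*2 + 3)%N.
Proof. by rewrite !card_sum !card_prod card_option card_bool !card_ord. Qed.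

Lemma card_grid_edge :
  #|edge grid| = (R * n.+1 + n.+1 * (R.*2).+1 + n.+1 * R.*2 + 2)%N.
Proof. by rewrite !card_sum !card_prod card_bool !card_ord. Qed.

Lemma row_vertex_quartic a p a' j :
  (row_vertex a p == quartic a' j) = (a == a' :> nat) && (p == j.+1).
Proof.
rewrite /row_vertex /column_vertex; case: p => [|p] /=; first by rewrite andbF.
case: insubP => [a1 _ <-|]; last first.
  by case: (a =P a' :> nat) => [->|//]; rewrite ltn_ord.
case: insubP => [j1 _ <-|]; last first.
  by rewrite eqSS; case: (p =P j :> nat) => [->|]; rewrite ?ltn_ord ?andbF.
by rewrite eqSS.
Qed.

Lemma row_vertex_cubic a p b i : (row_vertex a p == cubic b i) = false.
Proof. by rewrite /row_vertex; case: p => //= p; case: insubP => // *; case: insubP. Qed.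

Lemma row_vertexT a p : (a < R)%N -> (row_vertex a p == hubT) = (n < p)%N.
Proof.
move=> lt_a; rewrite /row_vertex; case: p => //= p.
rewrite (insubT (fun a => a < R)%N lt_a).
by case: insubP => [j lt_p _|]; [rewrite ltnS leqNgt lt_p|rewrite -leqNgt ltnS => ->].
Qed.

Lemma row_vertexU a p : (row_vertex a p == hubU) = false.
Proof. by rewrite /row_vertex; case: p => //= p; case: insubP => // *; case: insubP. Qed.

Lemma column_vertex_quartic b p a j : (column_vertex b p == quartic a j) = false.
Proof.
rewrite /row_vertex /column_vertex; case: p => [|p] /=; first by case: odd.
by case: insubP => [b1 _ _|_]; [case: insubP => // _|]; case: odd.
Qed.

Lemma column_vertex_cubic b p b' i :
  (column_vertex b p == cubic b' i) = (b == b' :> nat) && (p == i.+1).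
Proof.
rewrite /row_vertex /column_vertex; case: p => [|p] /=; first by case: odd; rewrite andbF.
case: insubP => [b1 _ <-|]; last first.
  by case: (b =P b' :> nat) => [->|_ _]; [rewrite ltn_ord|case: odd].
case: insubP => [i1 _ <-|]; first by rewrite eqSS.
by rewrite eqSS; case: (p =P i :> nat) => [->|]; rewrite ?ltn_ord ?andbF //; case: odd.
Qed.

Lemma column_vertexT b p : (column_vertex b p == hubT) = false.
Proof.
rewrite /row_vertex /column_vertex; case: p => [|p] /=; first by case: odd.
by case: insubP => [b1 _ _|_]; [case: insubP => // _|]; case: odd.
Qed.

Lemma column_vertexU b p : (b <= n)%N ->
  (column_vertex b p == hubU) = if odd b then (R.*2 < p)%N else p == 0%N.
Proof.
move=> le_b; rewrite /row_vertex /column_vertex; case: p => [|p] /=; first by case: odd.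
rewrite (insubT (fun b => b < n.+1)%N le_b) /=.
case: insubP => [i lt_p _|]; first by rewrite ltnS leqNgt lt_p /=; case: odd.
by rewrite -leqNgt ltnS => ->; case: odd.
Qed.


Lemma double_index_proof (a : 'I_R) (c : bool) : (c + a.*2 < R.*2)%N.
Proof. by have := ltn_ord a; lia. Qed.

Definition double_index a c : 'I_R.*2 := Ordinal (double_index_proof a c).


Lemma half_index_proof (i : 'I_R.*2) : (i./2 < R)%N.
Proof. by have := ltn_ord i; lia. Qed.

Definition half_index i : 'I_R := Ordinal (half_index_proof i).

(** * Conservation at the individual vertices of the grid *)

Section Nets.
Variables (V : zmodType) (x : edge grid -> V).

Lemma sum_grid_edge (P : pred grid_edge) : \sum_(e : edge grid | P e) x e =
  \sum_(c | P (row_edge c.1 c.2)) x (row_edge c.1 c.2) +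
  \sum_(c | P (column_edge c.1 c.2)) x (column_edge c.1 c.2) +
  \sum_(c | P (arm c.1 c.2)) x (arm c.1 c.2) +
  ((if P edgeTH then x edgeTH else 0) + (if P edgeUH then x edgeUH else 0)).
Proof.
have paired (I J : finType) (f : I * J -> grid_edge) :
    \sum_(c | P (f c)) x (f c) = \sum_(c | P (f (c.1, c.2))) x (f (c.1, c.2)).
  by apply: eq_big => -[].
rewrite !big_sumType [X in _ + X = _]big_mkcond big_bool.
by congr (_ + _ + _ + _); exact: paired.
Qed.

Let vertexE := (row_vertex_quartic, row_vertex_cubic, row_vertexU,
  column_vertex_quartic, column_vertex_cubic, column_vertexT).

Lemma net_cubic b i : net x (cubic b i) =
  x (column_edge b (lift ord0 i)) + x (arm b i) -
  x (column_edge b (widen_ord (leqnSn _) i)).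
Proof.
rewrite netE !sum_grid_edge /=.
rewrite [X in X + _ + _ + _ - _]big_pred0; last by move=> c; rewrite vertexE.
rewrite [X in _ - (X + _ + _ + _)]big_pred0; last by move=> c; rewrite vertexE.
rewrite (big_pred1 (b, lift ord0 i)); last by case=> b' i' /=; rewrite vertexE.
rewrite (big_pred1 (b, i)); last by case=> b' i' /=; rewrite vertexE.
rewrite (big_pred1 (b, widen_ord (leqnSn _) i)); last by case=> b' i' /=; rewrite vertexE.
rewrite big_pred0; last by move=> c; rewrite vertexE.
by rewrite !addr0 !add0r.
Qed.

Lemma net_quartic a j : net x (quartic a j) =
  x (row_edge a (lift ord0 j)) - (x (row_edge a (widen_ord (leqnSn _) j)) +
  (x (arm (lift ord0 j) (double_index a false)) +
   x (arm (widen_ord (leqnSn _) j) (double_index a true)))).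
Proof.
rewrite netE !sum_grid_edge /=.
rewrite (big_pred1 (a, lift ord0 j)); last by case=> b' i' /=; rewrite vertexE.
rewrite big_pred0; last by move=> c; rewrite vertexE.
rewrite big_pred0; last by move=> c; rewrite vertexE.
rewrite (big_pred1 (a, widen_ord (leqnSn _) j)); last by case=> b' i' /=; rewrite vertexE.
rewrite big_pred0; last by move=> c; rewrite vertexE.
rewrite (bigD1 (lift ord0 j, double_index a false)) /=; last first.
  by rewrite vertexE /= /bump; lia.
rewrite (big_pred1 (widen_ord (leqnSn _) j, double_index a true)).
  by rewrite !addr0.
case=> b' i' /=; rewrite vertexE !xpair_eqE -!val_eqE /= /bump /=; lia.
Qed.

Lemma net_hubT : net x (hubT : vertex grid) =
  x edgeTH - \sum_a (x (row_edge a ord_max) + x (arm ord_max (double_index a true))).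
Proof.
rewrite netE !sum_grid_edge /= big_split /=.
rewrite [X in X + _ + _ + _ - _]big_pred0; last first.
  by move=> c; rewrite row_vertexT // ltnNge -ltnS ltn_ord.
rewrite big_pred0; last by move=> c; rewrite vertexE.
rewrite big_pred0; last by move=> c; rewrite vertexE.
rewrite [X in _ - (_ + X + _ + _)]big_pred0; last by move=> c; rewrite vertexE.
rewrite !addr0 !add0r; congr (_ - (_ + _)).
  rewrite (eq_bigl (fun c => (c.1 \in 'I_R) && (c.2 == ord_max))).
    by rewrite -(pair_big (mem 'I_R) (pred1 ord_max) (fun a b => x (row_edge a b)));
      apply: eq_bigr => a _; rewrite big_pred1_eq.
  case=> a b /=; rewrite row_vertexT // -val_eqE /=; have := ltn_ord b; lia.
rewrite (eq_bigl (fun c : 'I_n.+1 * 'I_R.*2 => (c.1 == ord_max) && odd c.2)).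
  rewrite -(pair_big (pred1 ord_max) (fun i : 'I_R.*2 => odd i) (fun b i => x (arm b i))).
  rewrite big_pred1_eq (reindex_onto (double_index^~ true) half_index) /=.
    apply: eq_bigl => a; rewrite -val_eqE /=; lia.
  by move=> i odd_i; apply: val_inj => /=; lia.
case=> b i /=; rewrite row_vertexT -?val_eqE /=; have := ltn_ord b; have := ltn_ord i; lia.
Qed.

Lemma net_hubU : net x (hubU : vertex grid) =
  \sum_(b < n.+1 | ~~ odd b) x (column_edge b ord0) + x edgeUH -
  \sum_(b < n.+1 | odd b) x (column_edge b ord_max).
Proof.
rewrite netE !sum_grid_edge /=.
rewrite big_pred0; last by move=> c; rewrite vertexE.
rewrite [X in _ + X + _ - _]big_pred0; last first.
  by case=> b i /=; rewrite column_vertexU ?leq_ord //; have := ltn_ord i; case: odd; lia.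
rewrite [X in _ - (X + _ + _ + _)]big_pred0; last by move=> c; rewrite vertexE.
rewrite [X in _ - (_ + X + _)]big_pred0; last by move=> c; rewrite vertexE.
rewrite !addr0 !add0r; congr (_ + _ - _).
  rewrite (eq_bigl (fun c : 'I_n.+1 * 'I_(R.*2).+1 => ~~ odd c.1 && (c.2 == ord0))).
    by rewrite -(pair_big (fun b : 'I_n.+1 => ~~ odd b) (pred1 ord0)
      (fun b i => x (column_edge b i))); apply: eq_bigr => b _; rewrite big_pred1_eq.
  case=> b i /=; rewrite column_vertexU ?leq_ord // -val_eqE /=; have := ltn_ord i.
  by case: odd; lia.
rewrite (eq_bigl (fun c : 'I_n.+1 * 'I_(R.*2).+1 => odd c.1 && (c.2 == ord_max))).
  by rewrite -(pair_big (fun b : 'I_n.+1 => odd b) (pred1 ord_max)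
    (fun b i => x (column_edge b i))); apply: eq_bigr => b _; rewrite big_pred1_eq.
case=> b i /=; rewrite column_vertexU ?leq_ord // -val_eqE /=; have := ltn_ord i.
by case: odd; lia.
Qed.

End Nets.

End Grid.

(** * The grid has no nowhere-zero flow *)

Lemma alternating_sum (m : nat) : \sum_(b < m) (-1) ^+ b = (odd m)%:R :> 'F_3.
Proof.
elim: m => [|m IH]; first by rewrite big_ord0.
by rewrite big_ord_recr IH -signr_odd /=; case: odd; apply: val_inj.
Qed.

Lemma sum_even_odd (V : pzRingType) (m : nat) (F : 'I_m -> V) :
  \sum_(b < m | ~~ odd b) F b - \sum_(b < m | odd b) F b =
  \sum_(b < m) (-1) ^+ b * F b.
Proof.
rewrite [X in X - _]big_mkcond [X in _ - X]big_mkcond -sumrB; apply: eq_bigr => b _.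
by rewrite -signr_odd; case: odd; rewrite ?expr0 ?mul1r ?expr1 ?mulN1r ?subr0 ?sub0r.
Qed.

Section GridFlows.
Variables R n : nat.

Lemma grid_no_flow (x : edge (grid R n) -> 'F_3) : odd n ->
  conserving x -> ~ (forall e, x e != 0).
Proof.
move=> n_odd x_flow x_neq0.
have split_neq0 (a b c : 'F_3) : a + b - c = 0 -> a != 0 -> b != 0 -> c != 0 ->
    a = - c /\ b = - c.
  by case: (F3_cases a) => ->; case: (F3_cases b) => ->; case: (F3_cases c) => ->;
    split; apply: val_inj.
pose s b := x (column_edge b ord0).
have step b i : x (column_edge b (lift ord0 i)) =
      - x (column_edge b (widen_ord (leqnSn _) i)) /\
    x (arm b i) = - x (column_edge b (widen_ord (leqnSn _) i)).
  by apply: split_neq0; rewrite // -net_cubic x_flow.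
have columnE b i : x (column_edge b i) = (-1) ^+ i * s b.
  case: i => k lt_k; elim: k lt_k => [|k IH] lt_k.
    by rewrite mul1r; congr (x (column_edge b _)); apply: val_inj.
  have lt_k' : (k < R.*2)%N by [].
  have [+ _] := step b (Ordinal lt_k'); set i' := widen_ord _ _.
  rewrite (_ : i' = Ordinal (ltnW lt_k)) ?IH /=; last exact: val_inj.
  rewrite exprS mulN1r mulNr => <-.
  by congr (x (column_edge b _)); apply: val_inj.
have armE b i : x (arm b i) = - ((-1) ^+ i * s b).
  by have [_ ->] := step b i; rewrite columnE.
(* The row value plus the sign of the crossed column is invariant along a row. *)
pose w a := x (row_edge a ord0) + s ord0.
have rowE a b : x (row_edge a b) = w a - s b.
  case: b => k lt_k; elim: k lt_k => [|k IH] lt_k.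
    rewrite (_ : Ordinal lt_k = ord0); last exact: val_inj.
    by rewrite /w addrK.
  have lt_k' : (k < n)%N by [].
  have := x_flow (quartic a (Ordinal lt_k')); rewrite net_quartic.
  rewrite (_ : lift ord0 _ = Ordinal lt_k); last exact: val_inj.
  rewrite (_ : widen_ord _ _ = Ordinal (ltnW lt_k)); last exact: val_inj.
  rewrite IH !armE /= add0n exprS -signr_odd odd_double expr0 !mulN1r => /eqP.
  by rewrite subr_eq0 => /eqP ->; ring.
have s_neq0 b : s b != 0 by exact: x_neq0.
(* If all columns had the same sign, they would cancel at U, their number [n.+1] being even, and the
   edge between U and H would have value 0. *)
have [/existsP[b /existsP[b' bb']]|/existsPn s_const] :=
  boolP [exists b, exists b', s b != s b']; last first.
  have sE b : s b = s ord0.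
    by have /existsPn/(_ ord0) := s_const b; rewrite negbK => /eqP.
  have := x_flow (hubU R n); rewrite net_hubU addrAC.
  rewrite (eq_bigr (fun=> s ord0)) => [|b _]; last exact: sE.
  rewrite [X in _ - X + _](eq_bigr (fun=> s ord0)) => [|b _]; last first.
    by rewrite columnE sE -signr_odd odd_double mul1r.
  rewrite (sum_even_odd (fun=> s ord0)) -mulr_suml alternating_sum /= n_odd /=.
  by rewrite mul0r add0r => /eqP; apply/negP.
(* The signs [s b] and [s b'] are the two nonzero elements of Z/3, and [w a] differs from both. *)
have w0 a : w a = 0.
  have := x_neq0 (row_edge a b); have := x_neq0 (row_edge a b').
  rewrite !rowE; have := s_neq0 b; have := s_neq0 b'; move: bb'.
  by case: (F3_cases (s b)) => ->; case: (F3_cases (s b')) => ->;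
    case: (F3_cases (w a)) => ->.
(* Each row cancels at T against the arm of the last column that ends there. *)
have := x_flow (hubT R n); rewrite net_hubT big1 => [|a _].
  by rewrite subr0 => /eqP; apply/negP.
by rewrite rowE w0 armE /= exprS -signr_odd odd_double !mulN1r opprK sub0r addNr.
Qed.

(** * Flows from column signs and row potentials *)

Section Potential.
(** [S] is the column value without its alternation, and [G] generalizes the invariant [w] of a row:
    where [S] is constant along a column, the row value [G + 2 S] is [G - S]. *)
Variables (S G : nat -> nat -> 'F_3).

(* The value on the arms is the one forced by conservation at the cubic vertices;
   conservation at the quartic vertices becomes a recurrence for [G] alone. *)
Definition grid_flow (e : edge (grid R n)) : 'F_3 :=
  match e with
  | inl (inl (inl (a, b))) => G a b + S b a.*2 + S b (a.*2).+1
  | inl (inl (inr (b, i))) => (-1) ^+ i * S b i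
  | inl (inr (b, i)) => (-1) ^+ i * (S b i + S b i.+1)
  | inr true => \sum_(a < R) G a n.+1
  | inr false => - \sum_(b < n.+1) (-1) ^+ b * S b (if odd b then R.*2 else 0%N)
  end.

Lemma grid_flow_conserving :
  (forall a b, (a < R)%N -> (b <= n)%N ->
    G a b.+1 = G a b + S b a.*2 - S b (a.*2).+2) ->
  conserving grid_flow.
Proof.
move=> GS; apply: (@conserving_but_one (grid R n) _ _ (hubH R n)).
have even_sign (a : nat) : (-1) ^+ a.*2 = 1 :> 'F_3.
  by rewrite -signr_odd odd_double.
case=> [[[a j]|[b i]]|[[]|]] // _.
- rewrite (net_quartic _ a j) /= /bump /= !add0n add1n GS ?ltn_ord //; last exact: ltnW.
  by rewrite exprS even_sign; ring.
- by rewrite (net_cubic _ b i) /= /bump /= add1n exprS; ring.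
(* The recurrence at [b = n] makes each row deliver [G a n.+1] to T. *)
- rewrite net_hubT /= -sumrB big1 // => a _.
  by rewrite GS // exprS even_sign; ring.
- rewrite net_hubU /= addrAC.
  rewrite (eq_bigr (fun b : 'I_n.+1 => S b (if odd b then R.*2 else 0%N)))
    => [|b]; last first.
    by move/negPf ->; rewrite expr0 mul1r.
  rewrite [X in _ - X + _](eq_bigr (fun b : 'I_n.+1 => S b (if odd b then R.*2 else 0%N)))
    => [|b ->]; last by rewrite even_sign mul1r.
  by rewrite sum_even_odd subrr.
Qed.

End Potential.
End GridFlows.

(** Past [t] the sum is 2 (odd t) - (odd m), and 2 = -1 in Z/3. *)
Lemma alternating_sum_step (m t : nat) :
  \sum_(b < m) (-1) ^+ b * (if (b < t)%N then 1 else -1) =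
  (if (m <= t)%N then (odd m)%:R else - (odd t)%:R - (odd m)%:R) :> 'F_3.
Proof.
elim: m => [|m IH]; first by rewrite big_ord0.
rewrite big_ord_recr IH /= -signr_odd.
have [lt_mt|lt_tm|<-] := ltngtP m t; last by case: odd; apply: val_inj.
- by case: odd; apply: val_inj.
- by case: (odd m); case: (odd t); apply: val_inj.
Qed.

(** * Every edge of the grid can be the only zero of a flow *)

Section GridDeletions.
Variables R n : nat.
Hypothesis n_odd : odd n.
Hypothesis R_gt1 : (1 < R)%N.

(** The index of the edge of column [b] at U. *)
Let terminal b := if odd b then R.*2 else 0%N.

(** This and the next criterion keep the edge between U and H nonzero: here the signs seen at U
    switch once, after an odd number of columns; there a single column deviates. *)
Let step_neq0 (c : nat -> 'F_3) t : odd t -> (t <= n.+1)%N ->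
  (forall b, (b <= n)%N -> c b = if (b < t)%N then 1 else -1) ->
  \sum_(b < n.+1) (-1) ^+ b * c b != 0.
Proof.
move=> odd_t le_t cE; rewrite (eq_bigr (fun b : 'I_n.+1 =>
  (-1) ^+ b * (if (b < t)%N then 1 else -1))) => [|b _]; last by rewrite cE ?leq_ord.
rewrite alternating_sum_step /= n_odd odd_t; case: ifP => // le_nt.
have : n.+1 = t by lia.
by move=> nt; rewrite -nt /= n_odd in odd_t.
Qed.

Let single_neq0 (c : nat -> 'F_3) (s d : 'F_3) b0 : (b0 <= n)%N -> d != 0 ->
  (forall b, (b <= n)%N -> c b = s + (if b == b0 then d else 0)) ->
  \sum_(b < n.+1) (-1) ^+ b * c b != 0.
Proof.
move=> le_b0 d_neq0 cE; rewrite (eq_bigr (fun b : 'I_n.+1 =>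
  (-1) ^+ b * s + (if b == b0 :> nat then (-1) ^+ b * d else 0))) => [|b _]; last first.
  by rewrite cE ?leq_ord // mulrDr; case: eqP; rewrite ?mulr0.
rewrite big_split /= -mulr_suml alternating_sum /= n_odd mul0r add0r -big_mkcond /=.
rewrite (big_pred1 (Ordinal (le_b0 : (b0 < n.+1)%N))) //=.
by rewrite -signr_odd mulf_neq0 // signr_eq0.
Qed.

(** Keeps the edge between T and H nonzero: exactly one row arrives with nonzero potential. *)
Let sum_delta (a0 : nat) (c : 'F_3) (F : nat -> 'F_3) : (a0 < R)%N -> c != 0 ->
  (forall a, (a < R)%N -> F a = if a == a0 then c else 0) -> \sum_(a < R) F a != 0.
Proof.
move=> lt_a0 c_neq0 FE.
rewrite (eq_bigr (fun a : 'I_R => if a == a0 :> nat then c else 0)) => [|a _].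
  by rewrite -big_mkcond (big_pred1 (Ordinal lt_a0)).
exact: FE.
Qed.

Let deletable (e : edge (grid R n)) :=
  exists2 x : edge (grid R n) -> 'F_3, conserving x & forall f, f != e -> x f != 0.

Let deletableI (S G : nat -> nat -> 'F_3) (e : edge (grid R n)) :
  (forall a b, (a < R)%N -> (b <= n)%N ->
    G a b.+1 = G a b + S b a.*2 - S b (a.*2).+2) ->
  (forall (a : 'I_R) (b : 'I_n.+1), row_edge a b != e ->
    G a b + S b a.*2 + S b (a.*2).+1 != 0) ->
  (forall (b : 'I_n.+1) (i : 'I_(R.*2).+1), column_edge b i != e -> S b i != 0) ->
  (forall (b : 'I_n.+1) (i : 'I_R.*2), arm b i != e -> S b i + S b i.+1 != 0) ->
  (edgeTH R n != e -> \sum_(a < R) G a n.+1 != 0) ->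
  (edgeUH R n != e -> \sum_(b < n.+1) (-1) ^+ b * S b (terminal b) != 0) ->
  deletable e.
Proof.
move=> GS row_neq0 col_neq0 arm_neq0 TH_neq0 UH_neq0.
exists (grid_flow S G); first exact: grid_flow_conserving.
case=> [[[[a b]|[b i]]|[b i]]|[]] fe /=.
- exact: row_neq0 fe.
- by rewrite -signr_odd mulf_neq0 ?signr_eq0 //; exact: col_neq0 fe.
- by rewrite -signr_odd mulf_neq0 ?signr_eq0 //; exact: arm_neq0 fe.
- exact: TH_neq0 fe.
- by rewrite oppr_eq0; exact: UH_neq0 fe.
Qed.

Ltac by_cases :=
  repeat case: ifP => ?; try (by [] || by apply: val_inj); exfalso; lia.

Lemma deletable_row (a0 : 'I_R) (b0 : 'I_n.+1) : deletable (row_edge a0 b0).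
Proof.
(* [G - S] vanishes only where the row of potential 1 meets the column of sign 1. *)
pose S (b i : nat) : 'F_3 := if b == b0 then 1 else -1.
pose G (a b : nat) : 'F_3 := if a == a0 then 1 else 0.
apply: (@deletableI S G); rewrite /S /G.
- by move=> a b lt_a le_b; by_cases.
- move=> a b ne; have {}ne : ~~ ((a == a0 :> nat) && (b == b0 :> nat)) := ne.
  by_cases.
- by move=> b i _; by_cases.
- by move=> b i _; by_cases.
- by move=> _; apply: (@sum_delta a0 1 (G^~ n.+1)).
- move=> _.
  apply: (@single_neq0 (fun b => S b (terminal b)) (-1) (-1) b0); rewrite ?leq_ord //.
  move=> b _; rewrite /S; by_cases.
Qed.

Lemma deletable_TH : deletable (edgeTH R n).
Proof.
pose S (b i : nat) : 'F_3 := if b == 0%N then 1 else -1.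
apply: (@deletableI S (fun _ _ => 0)); rewrite /S //.
- by move=> a b lt_a le_b; by_cases.
- by move=> a b _; by_cases.
- by move=> b i _; by_cases.
- by move=> b i _; by_cases.
- move=> _.
  apply: (@single_neq0 (fun b => S b (terminal b)) (-1) (-1) 0%N); rewrite // => b _.
  rewrite /S; by_cases.
Qed.

Lemma deletable_UH : deletable (edgeUH R n).
Proof.
(* All columns have sign 1, so a row potential may be 0 or -1 but not 1. *)
pose G (a b : nat) : 'F_3 := if a == 0%N then -1 else 0.
apply: (@deletableI (fun _ _ => 1) G); rewrite /G //.
- by move=> a b lt_a le_b; by_cases.
- by move=> a b _; by_cases.
- by move=> _; apply: (@sum_delta 0%N (-1) (G^~ n.+1)) => //; lia.
Qed.

Lemma deletable_arm (b0 : 'I_n.+1) (i0 : 'I_R.*2) : deletable (arm b0 i0).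
Proof.
(* Column [b0] switches sign at the arm, which makes the arm zero; row [i0./2] absorbs the jump, its
   potential passing from -1 to 1. *)
pose S (b i : nat) : 'F_3 := if (b < b0)%N || (b == b0) && (i <= i0)%N then 1 else -1.
pose G (a b : nat) : 'F_3 := if a == i0./2 then if (b <= b0)%N then -1 else 1 else 0.
have lt_i0 := ltn_ord i0; have lt_b0 := ltn_ord b0.
apply: (@deletableI S G); rewrite /S /G.
- by move=> a b lt_a le_b; by_cases.
- by move=> a b _; by_cases.
- by move=> b i _; by_cases.
- move=> b i ne; have {}ne : ~~ ((b == b0 :> nat) && (i == i0 :> nat)) := ne.
  by_cases.
- move=> _; apply: (@sum_delta i0./2 1 (G^~ n.+1)) => // [|a lt_a]; first by lia.
  rewrite /G; by_cases.
- move=> _.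
  (* An even column [b0] shows U its sign before the switch, an odd one its sign after it; the
     number of leading columns with sign 1 is odd either way. *)
  apply: (@step_neq0 (fun b => S b (terminal b)) (if odd b0 then b0 : nat else b0.+1)).
  + by case: ifP => // /negbT.
  + by case: ifP => _; lia.
  + move=> b le_b; rewrite /S /terminal; case: (boolP (odd b0)) => ?;
      case: (boolP (odd b)) => ?; by_cases.
Qed.

Lemma deletable_column (b0 : 'I_n.+1) (k : 'I_(R.*2).+1) : deletable (column_edge b0 k).
Proof.
have lt_k := ltn_ord k; have lt_b0 := ltn_ord b0.
have [k0|k_gt0] := posnP k.
  have [b0_odd|b0_even] := boolP (odd b0).
    (* For odd [b0] the zero is at H, so U sees only nonzero signs and these must switch; for even
       [b0] the zero is at U and itself provides the deviating column. *)
    pose S (b i : nat) : 'F_3 :=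
      if (b == b0) && (i == 0%N) then 0 else if (b < b0)%N then 1 else -1.
    pose G (a b : nat) : 'F_3 := if (a == 0%N) && (b0 < b)%N then 1 else 0.
    apply: (@deletableI S G); rewrite /S /G.
    - by move=> a b lt_a le_b; by_cases.
    - by move=> a b _; by_cases.
    - move=> b i ne; have {}ne : ~~ ((b == b0 :> nat) && (i == k :> nat)) := ne.
      by_cases.
    - by move=> b i _; by_cases.
    - move=> _; apply: (@sum_delta 0%N 1 (G^~ n.+1)) => // [|a lt_a]; first by lia.
      rewrite /G; by_cases.
    - move=> _.
      apply: (@step_neq0 (fun b => S b (terminal b)) b0) => // [|b le_b]; first by lia.
      rewrite /S /terminal; case: (boolP (odd b)) => ?; by_cases.
  pose S (b i : nat) : 'F_3 := if (b == b0) && (i == 0%N) then 0 else 1.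
  pose G (a b : nat) : 'F_3 := if (a == 0%N) && (b0 < b)%N then -1 else 0.
  apply: (@deletableI S G); rewrite /S /G.
  - by move=> a b lt_a le_b; by_cases.
  - by move=> a b _; by_cases.
  - move=> b i ne; have {}ne : ~~ ((b == b0 :> nat) && (i == k :> nat)) := ne.
    by_cases.
  - by move=> b i _; by_cases.
  - move=> _; apply: (@sum_delta 0%N (-1) (G^~ n.+1)) => // [|a lt_a]; first by lia.
    rewrite /G; by_cases.
  - move=> _.
    apply: (@single_neq0 (fun b => S b (terminal b)) 1 (-1) b0) => // b le_b.
    rewrite /S /terminal; case: (boolP (odd b)) => ?; by_cases.
have [kR|k_neqR] := eqVneq (k : nat) R.*2.
  have [b0_odd|b0_even] := boolP (odd b0).
    pose S (b i : nat) : 'F_3 := if (b == b0) && (i == R.*2) then 0 else 1.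
    (* Row [R.-1] must go from -1 to 0, as potential 1 is barred by the columns of sign 1. So row 0,
       a different row since [R] exceeds 1, carries the value to T. *)
    pose G (a b : nat) : 'F_3 :=
      if (a == 0%N) || (a == R.-1) && (b <= b0)%N then -1 else 0.
    apply: (@deletableI S G); rewrite /S /G.
    - by move=> a b lt_a le_b; by_cases.
    - by move=> a b _; by_cases.
    - move=> b i ne; have {}ne : ~~ ((b == b0 :> nat) && (i == k :> nat)) := ne.
      by_cases.
    - by move=> b i _; by_cases.
    - move=> _; apply: (@sum_delta 0%N (-1) (G^~ n.+1)) => // [|a lt_a]; first by lia.
      rewrite /G; by_cases.
    - move=> _.
      apply: (@single_neq0 (fun b => S b (terminal b)) 1 (-1) b0) => // b le_b.
      rewrite /S /terminal; case: (boolP (odd b)) => ?; by_cases.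
  pose S (b i : nat) : 'F_3 :=
    if (b == b0) && (i == R.*2) then 0 else if (b <= b0)%N then 1 else -1.
  pose G (a b : nat) : 'F_3 := if (a == R.-1) && (b0 < b)%N then 1 else 0.
  apply: (@deletableI S G); rewrite /S /G.
  - by move=> a b lt_a le_b; by_cases.
  - by move=> a b _; by_cases.
  - move=> b i ne; have {}ne : ~~ ((b == b0 :> nat) && (i == k :> nat)) := ne.
    by_cases.
  - by move=> b i _; by_cases.
  - move=> _; apply: (@sum_delta R.-1 1 (G^~ n.+1)) => // [|a lt_a]; first by lia.
    rewrite /G; by_cases.
  - move=> _.
    apply: (@step_neq0 (fun b => S b (terminal b)) b0.+1) => // b le_b.
    rewrite /S /terminal; case: (boolP (odd b)) => ?; by_cases.
(* An interior zero. For odd [k] it lies within one row, and the potential there does not jump. For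
   even [k] it separates two rows, and the potential -1 passes from the later row to the earlier one
   at column [b0]. *)
pose S (b i : nat) : 'F_3 := if b == b0 then if i == k then 0 else -1 else 1.
pose G (a b : nat) : 'F_3 :=
  if odd k then if a == k./2 then -1 else 0
  else if (a == (k./2).-1) && (b0 < b)%N || (a == k./2) && (b <= b0)%N then -1 else 0.
apply: (@deletableI S G); rewrite /S /G.
- by move=> a b lt_a le_b; by_cases.
- by move=> a b _; by_cases.
- move=> b i ne; have {}ne : ~~ ((b == b0 :> nat) && (i == k :> nat)) := ne.
  by_cases.
- by move=> b i _; by_cases.
- move=> _.
  apply: (@sum_delta (if odd k then k./2 else (k./2).-1) (-1) (G^~ n.+1)) => // [|a lt_a].
    by case: ifP; lia.
  rewrite /G; by_cases.
- move=> _.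
  apply: (@single_neq0 (fun b => S b (terminal b)) 1 1 b0) => // b le_b.
  rewrite /S /terminal; case: (boolP (odd b)) => ?; by_cases.
Qed.

End GridDeletions.

Lemma adjacent_sym (G : mgraph) : symmetric (@adjacent G).
Proof. by move=> u v; apply: eq_existsb => e; rewrite orbC. Qed.

(** Summing the nets over the side of a bridge containing its first end leaves only the value of the
    bridge. *)
Lemma flow_not_bridge (G : mgraph) (V : zmodType) (x : edge G -> V) e :
  conserving x -> x e != 0 -> ~ bridge e.
Proof.
move=> x_flow xe_neq0 e_bridge.
pose A : {pred vertex G} := connect (@adjacent (delete_edge e)) (ends e).1.
have := sum_net x A; rewrite big1 // (bigD1 e) //=.
have -> : (ends e).1 \in A by exact: connect0.
have /negPf -> : (ends e).2 \notin A by apply/negP.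
rewrite subr0 big1 => [|f fe]; first by rewrite addr0 => /esym/eqP; apply/negP.
suff -> : ((ends f).1 \in A) = ((ends f).2 \in A) by rewrite subrr.
apply: (same_connect_r (sym_connect_sym (@adjacent_sym (delete_edge e)))).
apply: connect1; apply/existsP; exists (exist _ f fe : edge (delete_edge e)).
by rewrite /= -surjective_pairing eqxx.
Qed.

(** * Criticality of the grid *)

Section GridCritical.
Variables R n : nat.

Lemma grid_connected : connected_graph (grid R n).
Proof.
have edgeC (e : edge (grid R n)) : connect (@adjacent (grid R n)) (ends e).1 (ends e).2.
  by apply: connect1; apply/existsP; exists e; rewrite -surjective_pairing eqxx.
have C_sym := sym_connect_sym (@adjacent_sym (grid R n)).
pose C (v : grid_vertex R n) := connect (@adjacent (grid R n)) v (hubH R n).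
have rowC (a : 'I_R) p : (p <= n.+1)%N -> C (row_vertex R n a p).
  elim: p => [|p IH] le_p; first exact: connect0.
  have := edgeC (row_edge a (Ordinal le_p)); rewrite C_sym /= => /connect_trans; apply.
  by apply: IH; exact: ltnW.
have TC : C (hubT R n) by exact: (edgeC (edgeTH R n)).
have UC : C (hubU R n) by exact: (edgeC (edgeUH R n)).
have columnC (b : 'I_n.+1) p : (p <= (R.*2).+1)%N -> C (column_vertex R n b p).
  elim: p => [|p IH] le_p.
    by rewrite /column_vertex; case: odd => //; exact: connect0.
  have := edgeC (column_edge b (Ordinal le_p)); rewrite C_sym /= => /connect_trans; apply.
  by apply: IH; exact: ltnW.
have allC v : C v.
  case: v => [[[a j]|[b i]]|[[]|]] //; last exact: connect0.
    have := rowC a j.+1; rewrite /row_vertex !valK; apply.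
    by apply: leqW; exact: ltn_ord.
  have := columnC b i.+1; rewrite /column_vertex !valK; apply.
  by apply: leqW; exact: ltn_ord.
by move=> u v; apply: connect_trans (allC u) _; rewrite C_sym; exact: allC.
Qed.

Hypotheses (n_odd : odd n) (R_gt1 : (1 < R)%N).

Lemma grid_deletable (e : edge (grid R n)) : exists2 x : edge (grid R n) -> 'F_3,
  conserving x & forall f, f != e -> x f != 0.
Proof.
case: e => [[[[a b]|[b i]]|[b i]]|[]].
- exact: deletable_row.
- exact: deletable_column.
- exact: deletable_arm.
- exact: deletable_TH.
- exact: deletable_UH.
Qed.

Theorem grid_critical : three_flow_critical (grid R n).
Proof.
split.
- exact: grid_connected.
(* A flow vanishing only on some edge other than [e] is nonzero on [e]. *)
- move=> e; pose f : edge (grid R n) := if e == edgeTH R n then edgeUH R n else edgeTH R n.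
  have [x x_flow x_neq0] := grid_deletable f.
  apply: (flow_not_bridge x_flow); apply: x_neq0.
  by rewrite /f; have [->|] := eqVneq e (edgeTH R n).
- by move=> /nowhere_zero_3_flowP[x x_flow]; exact: (grid_no_flow n_odd x_flow).
- by move=> e; apply/contract_flowP; exact: grid_deletable.
Qed.

End GridCritical.

(** * Densities and the limit inferior *)

Section Liminf.
Variables (K : realType) (u : (\bar K)^nat) (l : K).

Lemma limn_einf_ge :
  (forall e : K, 0 < e -> exists N, forall k, (N <= k)%N -> ((l - e)%:E <= u k)%E) ->
  (l%:E <= limn_einf u)%E.
Proof.
move=> u_ge; rewrite limn_einf_lim; apply/lee_subgt0Pr => e /u_ge[N u_geN].
apply: lime_ge; first exact: is_cvg_einfs.
exists N => // k /= le_Nk; apply: le_ereal_inf_tmp => _ [p /= le_kp <-].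
by apply: u_geN; exact: leq_trans le_kp.
Qed.

Lemma limn_einf_le :
  (forall (e : K) N, 0 < e -> exists2 k, (N <= k)%N & (u k <= (l + e)%:E)%E) ->
  (limn_einf u <= l%:E)%E.
Proof.
move=> u_le; rewrite limn_einf_lim; apply/lee_addgt0Pr => e e_gt0.
apply: lime_le; first exact: is_cvg_einfs.
apply: nearW => N; have [k le_Nk u_lek] := u_le e N e_gt0.
by apply: le_trans u_lek; apply: ereal_inf_lbound; exists k.
Qed.

End Liminf.

Lemma density_critical_ge (K : realType) (G : mgraph) (e : K) :
  three_flow_critical G -> (1 < #|vertex G|)%N -> 0 < e ->
  e^-1 <= #|vertex G|%:R -> 8 / 5 - e <= density K G.
Proof.
move=> G_crit G_gt1 e_gt0 le_e.
have [r _] : exists r : vertex G, true by move: (ltnW G_gt1) => /card_gt0P[r _]; exists r.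
have := critical_edge_bound G_crit G_gt1 r.
rewrite -(ler_nat K) natrD !natrM => bound.
have V_gt0 : 0 < #|vertex G|%:R :> K by rewrite ltr0n ltnW.
have eV : 1 <= e * #|vertex G|%:R by rewrite mulrC -ler_pdivrMr // mul1r.
rewrite /density ler_pdivlMr //; nra.
Qed.

Lemma density_grid_le (K : realType) (k : nat) (e : K) : (1 < k)%N -> 0 < e ->
  e^-1 <= k%:R -> density K (grid k (k.*2).-1) <= 5 / 3 + e.
Proof.
move=> k_gt1 e_gt0 le_e.
have ek : 1 <= e * k%:R by rewrite mulrC -ler_pdivrMr // mul1r.
have V_gt0 : 0 < #|vertex (grid k (k.*2).-1)|%:R :> K.
  by rewrite ltr0n card_grid_vertex addn3.
rewrite /density ler_pdivrMr // card_grid_vertex card_grid_edge.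
have -> : ((k.*2).-1.+1 = k.*2)%N by lia.
have -> : (k * (k.*2).-1 + k.*2 * k.*2 + 3 = 6 * k * k - k + 3)%N by nia.
have -> : (k * k.*2 + k.*2 * k.*2.+1 + k.*2 * k.*2 + 2 = 10 * k * k + 2 * k + 2)%N by nia.
have le_k : (k <= 6 * k * k)%N by nia.
rewrite !natrD natrB // !natrM.
have : 2 <= k%:R :> K by rewrite (ler_nat K 2).
(* The excess 11k - 9 is at most 3 e |V|, since e k >= 1 and |V| is quadratic in k. *)
nra.
Qed.

Theorem mainTheorem2 (R : realType) :
  ((8 / 5 : R)%:E <= liminf_critical_density R)%E /\
  (liminf_critical_density R <= (5 / 3 : R)%:E)%E.
Proof.
have bound (e : R) : 0 < e -> e^-1 <= (Num.bound e^-1)%:R.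
  by move=> e_gt0; apply/ltW/archi_boundP; rewrite invr_ge0 ltW.
split.
  apply: limn_einf_ge => e e_gt0; exists (Num.bound e^-1 + 2)%N => n le_n.
  apply: le_ereal_inf_tmp => _ [G [G_crit card_G ->]]; rewrite lee_fin.
  apply: density_critical_ge => //; rewrite card_G; first by lia.
  by apply: le_trans (bound e e_gt0) _; rewrite ler_nat; lia.
apply: limn_einf_le => e N e_gt0.
pose k := (N + Num.bound e^-1 + 2)%N.
have n_odd : odd (k.*2).-1 by rewrite /k; lia.
have k_gt1 : (1 < k)%N by rewrite /k; lia.
(* Grids need only realize arbitrarily large vertex counts, not all of them. *)
exists #|vertex (grid k (k.*2).-1)|.
  by rewrite card_grid_vertex; rewrite /k; nia.
apply: (@le_trans _ _ (density R (grid k (k.*2).-1))%:E).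
  apply: ereal_inf_lbound; exists (grid k (k.*2).-1); split=> //.
  exact: grid_critical.
rewrite lee_fin; apply: density_grid_le => //.
by apply: le_trans (bound e e_gt0) _; rewrite ler_nat /k; lia.
Qed.
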